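(* Let $(f_0,\hat f_0)$ and $(f_0,\hat f_1)$ be Ribaucour pairs of Legendre maps $M\to\mathcal{Z}$ of an $m$-manifold $M$ whose sphere congruences $s_i=f_0\cap\hat f_i$ ($i=0,1$) are pointwise distinct, and let $V=\hat f_0\oplus\hat f_1$ with its induced metric connection $\nabla$. Let $f_1:M\to\mathcal{Z}$ be a Legendre map which is a simultaneous Ribaucour transform of $\hat f_0$ and $\hat f_1$ and which is pointwise distinct from $f_0$. Then $\nabla$ is flat and all four bundles $f_0,f_1,\hat f_0,\hat f_1$ are $\nabla$-parallel subbundles of $V$.
   Context: All manifolds, maps and bundles are smooth. $\mathbb{R}^{m+2,2}$ is an $(m+4)$-dimensional real vector space with metric $(\,,\,)$ of signature $(m+2,2)$; $\mathcal{Q}$ is its projective light-cone (the set of null lines) and $\mathcal{Z}$ the Grassmannian of null (totally isotropic) $2$-planes. A map of $M$ into a Grassmannian is identified with the corresponding subbundle of $M\times\mathbb{R}^{m+2,2}$; $\Gamma f$ denotes sections. A sphere congruence is a map $s:M\to\mathcal{Q}$. A map $f:M\to\mathcal{Z}$ is Legendre if $(\mathrm{d}\sigma_0,\sigma_1)\equiv0$ for all $\sigma_0,\sigma_1\in\Gamma f$; it envelops $s$ if $s(p)\subset f(p)$ for all $p$. If two pointwise distinct Legendre maps $f,\hat f$ envelop a common sphere congruence $s=f\cap\hat f$, let $\mathcal{N}_{f,\hat f}=(f+\hat f)/s\subset s^\perp/s$, on which the metric has signature $(1,1)$, let $\pi:s^\perp/s\to\mathcal{N}_{f,\hat f}$ be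 orthogonal projection, and let $\nabla^{f,\hat f}(\nu+s)=\pi(\mathrm{d}\nu+s)$ for $\nu\in\Gamma(f+\hat f)$; this is a metric connection. $(f,\hat f)$ is a Ribaucour pair (and $f,\hat f$ are Ribaucour transforms of each other) if $\nabla^{f,\hat f}$ is flat. When $s_0,s_1$ are pointwise distinct, $\hat f_0\cap\hat f_1=\{0\}$ pointwise, and $V=\hat f_0\oplus\hat f_1\subset M\times\mathbb{R}^{m+2,2}$ has rank $4$ and inherits a metric of signature $(2,2)$ and a metric connection $\nabla$ obtained by orthogonally projecting $\mathrm{d}$ to $V$. *)

(* Defs.v *)
From mathcomp Require Import all_boot all_order all_algebra.
From mathcomp Require Import all_classical all_reals all_analysis.
Import Order.TTheory GRing.Theory Num.Theory.
Import numFieldNormedType.Exports.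

Set Implicit Arguments.
Unset Strict Implicit.
Unset Printing Implicit Defensive.

Local Open Scope classical_set_scope.
Local Open Scope ring_scope.

(* Smoothness is only ever used on open sets [U], where existence and
   continuity of all iterated directional derivatives is C^oo smoothness. *)
Fixpoint Ck_on (R : realType) (m : nat) (W : normedModType R) (k : nat)
    (U : set 'rV[R]_m) (f : 'rV[R]_m -> W) : Prop :=
  (forall x, U x -> {for x, continuous f}) /\
  match k with
  | 0%N => True
  | k'.+1 => forall v : 'rV[R]_m,
      (forall x, U x -> derivable f x v) /\ Ck_on k' U (fun x => 'D_v f x)
  end.

Definition smooth_on (R : realType) (m : nat) (W : normedModType R)
    (U : set 'rV[R]_m) (f : 'rV[R]_m -> W) : Prop :=
  forall k, Ck_on k U f.

(* [chart_map] and [chart_inv] are total; only their restrictions to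
   [chart_dom] and to its image are meaningful. *)
Record chart (R : realType) (m : nat) (M : topologicalType) := Chart {
  chart_dom : set M;
  chart_map : M -> 'rV[R]_m;
  chart_inv : 'rV[R]_m -> M;
  chart_dom_open : open chart_dom;
  chart_img_open : open (chart_map @` chart_dom);
  chart_mapK : forall p, chart_dom p -> chart_inv (chart_map p) = p;
  chart_map_continuous :
    forall p, chart_dom p -> {for p, continuous chart_map};
  chart_inv_continuous :
    forall x, (chart_map @` chart_dom) x -> {for x, continuous chart_inv} }.

Record manifold (R : realType) (m : nat) := Manifold {
  carrier :> topologicalType;
  atlas : set (chart R m carrier);
  manifold_hausdorff : hausdorff_space carrier;
  manifold_second_countable : @second_countable carrier;
  atlas_cover : forall p : carrier, exists2 c, atlas c & chart_dom c p;
  atlas_compatible : forall c d, atlas c -> atlas d ->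
    smooth_on (chart_map c @` (chart_dom c `&` chart_dom d))
              (chart_map d \o chart_inv c) }.

Definition smooth (R : realType) (m : nat) (M : manifold R m)
    (W : normedModType R) (U : set M) (f : M -> W) : Prop :=
  forall c, atlas c ->
    smooth_on (chart_map c @` (chart_dom c `&` U)) (f \o chart_inv c).

(* A tangent vector at [p] is a derivation at [p] of the algebra of smooth
   functions; values on non-smooth functions are irrelevant. *)
Definition tangent_vector (R : realType) (m : nat) (M : manifold R m) (p : M)
    (v : (M -> R) -> R) : Prop :=
  forall g h : M -> R, smooth setT g -> smooth setT h ->
    (forall a : R, v (fun q => a * g q + h q) = a * v g + v h) /\
    v (fun q => g q * h q) = g p * v h + h p * v g.

Definition vector_field (R : realType) (m : nat) (M : manifold R m)
    (X : M -> (M -> R) -> R) : Prop :=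
  (forall p, tangent_vector p (X p)) /\
  (forall g : M -> R, smooth setT g -> smooth setT (fun p => X p g : R)).

Definition lie_bracket (R : realType) (m : nat) (M : manifold R m)
    (X Y : M -> (M -> R) -> R) : M -> (M -> R) -> R :=
  fun p g => X p (fun q => Y q g) - Y p (fun q => X q g).

(* [dvec v sigma] is [d sigma (v)] for a map [sigma] into a space of rows. *)
Definition dvec (R : realType) (m : nat) (M : manifold R m) (n : nat)
    (v : (M -> R) -> R) (sigma : M -> 'rV[R]_n) : 'rV[R]_n :=
  \row_j v (fun q => sigma q 0 j).

Definition has_signature (R : realType) (a b : nat) (G : 'M[R]_(a + b)) :=
  exists2 P : 'M[R]_(a + b), P \in unitmx &
    P *m G *m P^T = diag_mx (row_mx (const_mx 1) (const_mx (-1))).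

Definition form (R : realType) (n : nat) (G : 'M[R]_n) (x y : 'rV[R]_n) : R :=
  (x *m G *m y^T) 0 0.

Definition isotropic (R : realType) (n : nat) (G : 'M[R]_n)
    (U : {vspace 'rV[R]_n}) : Prop :=
  forall x y, x \in U -> y \in U -> form G x y = 0.

(* Smooth rank [k] subbundles of the trivial bundle, equivalently smooth maps
   into the Grassmannian of [k]-planes. *)
Definition subbundle (R : realType) (m : nat) (M : manifold R m) (n k : nat)
    (F : M -> {vspace 'rV[R]_n}) : Prop :=
  forall p, exists U : set M, exists e : 'I_k -> M -> 'rV[R]_n,
    [/\ open U, U p, forall i, smooth U (e i) &
        forall q, U q -> basis_of (F q) [tuple e i q | i < k]].

Definition is_section (R : realType) (m : nat) (M : manifold R m) (n : nat)
    (F : M -> {vspace 'rV[R]_n}) (sigma : M -> 'rV[R]_n) : Prop :=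
  smooth setT sigma /\ forall p, sigma p \in F p.

Definition sphere_congruence (R : realType) (m : nat) (M : manifold R m)
    (n : nat) (G : 'M[R]_n) (s : M -> {vspace 'rV[R]_n}) : Prop :=
  subbundle 1 s /\ forall p, isotropic G (s p).

Definition legendre (R : realType) (m : nat) (M : manifold R m)
    (n : nat) (G : 'M[R]_n) (f : M -> {vspace 'rV[R]_n}) : Prop :=
  [/\ subbundle 2 f,
      forall p, isotropic G (f p) &
      forall sigma0 sigma1, is_section f sigma0 -> is_section f sigma1 ->
        forall p v, tangent_vector p v ->
          form G (dvec v sigma0) (sigma1 p) = 0].

Definition envelops (R : realType) (m : nat) (M : manifold R m) (n : nat)
    (f s : M -> {vspace 'rV[R]_n}) : Prop :=
  forall p, (s p <= f p)%VS.

(* Elements of a quotient space are represented by cosets. *)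
Definition coset (R : realType) (n : nat) (s : {vspace 'rV[R]_n})
    (x : 'rV[R]_n) : set 'rV[R]_n := [set w | w - x \in s].

Definition coset_sub (R : realType) (n : nat) (A B : set 'rV[R]_n) :
  set 'rV[R]_n := [set a - b | a in A & b in B].

(* For [s] the radical of [W], this is the orthogonal projection from the
   orthogonal of [s] modulo [s] onto [W] modulo [s]: the result is the coset of
   those [u] in [W] whose class differs from the class [c] by a class orthogonal
   to all of [W]. *)
Definition quot_proj (R : realType) (n : nat) (G : 'M[R]_n)
    (W : {vspace 'rV[R]_n}) (c : set 'rV[R]_n) : set 'rV[R]_n :=
  [set u | u \in W /\
     exists2 w, c w & forall x, x \in W -> form G (w - u) x = 0].

(* [nablaN G f fh p v nu] is the covariant derivative at [p] along [v] of the
   section [nu + s] of [(f + fh) / s], where [s] is the intersection of [f] and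
   [fh] and [nu] is a section of [f + fh]. *)
Definition nablaN (R : realType) (m : nat) (M : manifold R m) (n : nat)
    (G : 'M[R]_n) (f fh : M -> {vspace 'rV[R]_n}) (p : M)
    (v : (M -> R) -> R) (nu : M -> 'rV[R]_n) : set 'rV[R]_n :=
  quot_proj G (f p + fh p)%VS (coset (f p :&: fh p)%VS (dvec v nu)).

(* Vanishing of the curvature; [muX] and [muY] are lifts to [f + fh] of the
   sections obtained by differentiating [nu + s] along [X] and [Y]. *)
Definition flatN (R : realType) (m : nat) (M : manifold R m) (n : nat)
    (G : 'M[R]_n) (f fh : M -> {vspace 'rV[R]_n}) : Prop :=
  forall X Y : M -> (M -> R) -> R, vector_field X -> vector_field Y ->
  forall nu muX muY : M -> 'rV[R]_n,
    is_section (fun p => f p + fh p)%VS nu ->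
    is_section (fun p => f p + fh p)%VS muX ->
    is_section (fun p => f p + fh p)%VS muY ->
    (forall p, coset (f p :&: fh p)%VS (muX p) = nablaN G f fh p (X p) nu) ->
    (forall p, coset (f p :&: fh p)%VS (muY p) = nablaN G f fh p (Y p) nu) ->
  forall p,
    coset_sub (coset_sub (nablaN G f fh p (X p) muY)
                         (nablaN G f fh p (Y p) muX))
              (nablaN G f fh p (lie_bracket X Y p) nu)
    = coset (f p :&: fh p)%VS 0.

Definition ribaucour_pair (R : realType) (m : nat) (M : manifold R m)
    (n : nat) (G : 'M[R]_n) (f fh : M -> {vspace 'rV[R]_n}) : Prop :=
  [/\ legendre G f, legendre G fh, forall p, f p <> fh p,
      exists s, [/\ sphere_congruence G s, envelops f s, envelops fh s &
                    forall p, s p = (f p :&: fh p)%VS] &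
      flatN G f fh].

Definition orth_proj (R : realType) (n : nat) (G : 'M[R]_n)
    (W : {vspace 'rV[R]_n}) (w : 'rV[R]_n) : 'rV[R]_n :=
  xget 0 [set u | u \in W /\ forall x, x \in W -> form G (w - u) x = 0].

Definition nabla (R : realType) (m : nat) (M : manifold R m) (n : nat)
    (G : 'M[R]_n) (V : M -> {vspace 'rV[R]_n}) (p : M)
    (v : (M -> R) -> R) (sigma : M -> 'rV[R]_n) : 'rV[R]_n :=
  orth_proj G (V p) (dvec v sigma).

Definition flat (R : realType) (m : nat) (M : manifold R m) (n : nat)
    (G : 'M[R]_n) (V : M -> {vspace 'rV[R]_n}) : Prop :=
  forall X Y : M -> (M -> R) -> R, vector_field X -> vector_field Y ->
  forall sigma, is_section V sigma ->
  forall p,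
    nabla G V p (X p) (fun q => nabla G V q (Y q) sigma)
    - nabla G V p (Y p) (fun q => nabla G V q (X q) sigma)
    - nabla G V p (lie_bracket X Y p) sigma = 0.

Definition parallel_subbundle (R : realType) (m : nat) (M : manifold R m)
    (n k : nat) (G : 'M[R]_n) (V F : M -> {vspace 'rV[R]_n}) : Prop :=
  [/\ subbundle k F,
      forall p, (F p <= V p)%VS &
      forall sigma, is_section F sigma ->
        forall p v, tangent_vector p v -> nabla G V p v sigma \in F p].

(* Main.v *)
(* At each point put a, b, c, d for generators of the lines f0 :&: fh0,
   f0 :&: fh1, f1 :&: fh0, f1 :&: fh1. Since the four planes are isotropic and
   isotropic subspaces have dimension at most 2, the only nonzero pairings are
   (a, d) and (b, c); so a, b, c, d span V, and each of the four planes is its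
   own orthogonal in V. The Legendre condition for a plane F says that
   nabla s is orthogonal to F for s a section of F, so F is parallel, and hence
   so are the four lines. For a section s of the line f0 :&: fh0, the connection
   of V agrees with that of (f0 + fh1) / (f0 :&: fh1), whose flatness puts the
   curvature of V at s in f0 :&: fh1; it also lies in the parallel line
   f0 :&: fh0, so it vanishes. The same holds for the three other lines.

   A derivation is only controlled on global smooth functions, so the Legendre
   condition is tested on global sections, obtained from local frames by bump
   functions. *)

Require Import Defs.
From mathcomp Require Import all_boot all_order all_algebra.
From mathcomp Require Import all_classical all_reals all_analysis.
From mathcomp Require Import ring.
Import Order.TTheory GRing.Theory Num.Theory.
Import numFieldNormedType.Exports.
Import Defs.

Set Implicit Arguments.
Unset Strict Implicit.
Unset Printing Implicit Defensive.

Local Open Scope classical_set_scope.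
Local Open Scope ring_scope.

(** * Smooth maps on open sets of the model space *)

Section Ck_general.
Context {R : realType} {m : nat} {W : normedModType R}.
Implicit Types (U O : set 'rV[R]_m) (f g : 'rV[R]_m -> W).

Lemma Ck_on_sub k U O f : O `<=` U -> Ck_on k U f -> Ck_on k O f.
Proof.
move=> OU; elim: k f => [|k IH] f [fc fd].
  by split=> // x /OU; exact: fc.
split=> [x /OU|v]; first exact: fc.
have [fdv fk] := fd v.
by split=> [x /OU|]; [exact: fdv|exact: IH].
Qed.

(** [Ck_on] imposes conditions at single points, each seeing only the germ of [f] there, so the sets
    [O] may be arbitrary. *)
Lemma Ck_on_local k U f :
  (forall x, U x -> exists2 O, O x & Ck_on k O f) -> Ck_on k U f.
Proof.
elim: k f => [|k IH] f fU; split => //.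
- by move=> x /fU[N Nx [fc _]]; exact: fc.
- by move=> x /fU[N Nx [fc _]]; exact: fc.
move=> v; split=> [x /fU[N Nx [_ fd]]|]; first exact: (fd v).1.
by apply: IH => x /fU[N Nx [_ fd]]; exists N => //; exact: (fd v).2.
Qed.

Lemma near_eq_continuous f g x : (\near x, f x = g x) ->
  {for x, continuous f} -> {for x, continuous g}.
Proof.
move=> fg fc; have fgx := nbhs_singleton fg.
apply: cvg_trans (_ : f @ x --> g x).
  exact: near_eq_cvg fg.
by rewrite -fgx; exact: fc.
Qed.

(** Openness of [U] turns equality on [U] into equality near each of its points, so that the
    derivatives agree as well. *)
Lemma Ck_on_eq k U f g : open U -> (forall x, U x -> f x = g x) ->
  Ck_on k U f -> Ck_on k U g.
Proof.
move=> Uo; elim: k f g => [|k IH] f g fg [fc fd];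
  have nfg x : U x -> \near x, f x = g x
    by move=> Ux; apply: filterS fg _; exact: open_nbhs_nbhs.
- by split=> // x Ux; apply: near_eq_continuous (nfg x Ux) (fc x Ux).
- split=> [x Ux|v]; first by apply: near_eq_continuous (nfg x Ux) (fc x Ux).
  have [fdv fk] := fd v; split=> [x Ux|].
    by apply: near_eq_derivable (fdv x Ux); exact: nfg.
  by apply: IH fk => x Ux; apply: near_eq_derive; exact: nfg.
Qed.

Lemma Ck_on_pred k U f : Ck_on k.+1 U f -> Ck_on k U f.
Proof.
elim: k f => [|k IH] f [fc fd]; first by split.
by split=> // v; have [? /IH] := fd v.
Qed.

Lemma Ck_on_continuous k U f x : Ck_on k U f -> U x -> {for x, continuous f}.
Proof. by case: k => [|k] [fc _]; exact: fc. Qed.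

End Ck_general.

Section Ck_scalar.
Context {R : realType} {m : nat}.
Implicit Types (U O : set 'rV[R]_m) (f g : 'rV[R]_m -> R).

Lemma Ck_on_cst (W : normedModType R) k U (c : W) : Ck_on k U (fun=> c).
Proof.
elim: k c => [|k IH] c; split => //; try by move=> x _; exact: cst_continuous.
move=> v; split=> [x _|]; first exact: derivable_cst.
have -> : (fun x => 'D_v (fun=> c) x) = fun=> (0 : W); last exact: IH.
by apply/funext => x; exact: derive_cst.
Qed.

Lemma Ck_on_add k U f g : open U -> Ck_on k U f -> Ck_on k U g ->
  Ck_on k U (fun x => f x + g x).
Proof.
move=> Uo; elim: k f g => [|k IH] f g [fc fd] [gc gd]; split => //;
  try by move=> x Ux; apply: continuousD; [exact: fc|exact: gc].
move=> v; have [fv fk] := fd v; have [gv gk] := gd v; split=> [x Ux|].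
  by apply: derivableD; [exact: fv|exact: gv].
apply: Ck_on_eq (IH _ _ fk gk) => // x Ux.
by rewrite -deriveD//; [exact: fv|exact: gv].
Qed.

Lemma Ck_on_mul k U f g : open U -> Ck_on k U f -> Ck_on k U g ->
  Ck_on k U (fun x => f x * g x).
Proof.
move=> Uo; elim: k f g => [|k IH] f g fk gk; split => //;
  try by move=> x Ux; apply: continuousM;
     [exact: Ck_on_continuous fk _|exact: Ck_on_continuous gk _].
move=> v; have [_ /(_ v)[fv fk']] := fk; have [_ /(_ v)[gv gk']] := gk.
split=> [x Ux|].
  by apply: derivableM; [exact: fv|exact: gv].
have := Ck_on_add Uo (IH _ _ (Ck_on_pred fk) gk') (IH _ _ (Ck_on_pred gk) fk').
apply: Ck_on_eq => // x Ux.
by rewrite [RHS]deriveM//; [exact: fv|exact: gv].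
Qed.

Lemma Ck_on_inv k U f : open U -> (forall x, U x -> f x != 0) -> Ck_on k U f ->
  Ck_on k U (fun x => (f x)^-1).
Proof.
move=> Uo f0; elim: k => [|k IH] fk; split => //;
  try by move=> x Ux; apply: continuousV; [exact: f0|exact: Ck_on_continuous fk _].
move=> v; have [_ /(_ v)[fv fk']] := fk.
split=> [x Ux|]; first by apply: derivableV; [exact: f0|exact: fv].
have fV := IH (Ck_on_pred fk).
(* The derivative [- f' / f^2] of [1/f] is written as a product of functions already known to be of
   class [k]. *)
have := Ck_on_mul Uo (Ck_on_mul Uo (Ck_on_mul Uo fV fV) (@Ck_on_cst R k U (-1))) fk'.
apply: Ck_on_eq => // x Ux.
rewrite deriveV; [|exact: f0|exact: fv].
by rewrite mulrN1 -expr2 exprVn.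
Qed.

(** Along the line [h |-> h *: v + x] this is the chain rule in one variable. *)
Lemma derive_comp_real f (B : R -> R) (b' : R) x v : derivable f x v ->
  is_derive (f x) 1 B b' -> is_derive x v (B \o f) (b' * 'D_v f x).
Proof.
move=> fxv Bfx.
have f1 : derivable (fun h : R => f (h *: v + x)) 0 1
  by exact: (derivable1P _ _ _).1 fxv.
have f0 : f (0 *: v + x) = f x by rewrite scale0r add0r.
have Bd : derivable B (f (0 *: v + x)) 1 by rewrite f0; case: Bfx.
have e0 (g : 'rV[R]_m -> R) : 'D_v g x = 'D_1 (fun h : R => g (h *: v + x)) 0.
  rewrite /derive; set g1 := fun h => h^-1 *: _; set g2 := fun h => h^-1 *: _.
  suff -> : g1 = g2 by [].
  by apply/funext => h; rewrite /g1 /g2 /= addr0 scale0r add0r [_%:A]mulr1.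
apply: DeriveDef => /=.
  apply: (derivable1P (B \o f) x v).2; apply/derivable1_diffP.
  apply: (@differentiable_comp _ _ _ _ (fun h : R => f (h *: v + x)) B).
    exact/derivable1_diffP.
  exact/derivable1_diffP.
rewrite !e0 -!derive1E (derive1_comp f1 Bd) f0 derive1E.
by case: Bfx => _ ->.
Qed.

(** The sequence [B] lists the successive derivatives of [B 0]. Proving the claim for all [n] at
    once lets the induction on [k] absorb the factor [B n.+1] produced by the chain rule. *)
Lemma Ck_on_comp_real (B : nat -> R -> R) k U f : open U ->
  (forall n (x : R), is_derive x 1 (B n) (B n.+1 x)) -> Ck_on k U f ->
  forall n, Ck_on k U (fun x => B n (f x)).
Proof.
move=> Uo Bd.
have cB k0 (f0 : 'rV[R]_m -> R) n x : Ck_on k0 U f0 -> U x ->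
    {for x, continuous (fun y => B n (f0 y))}.
  move=> fk Ux; apply: (@continuous_comp _ _ _ f0 (B n)).
    exact: Ck_on_continuous fk Ux.
  by apply/differentiable_continuous/derivable1_diffP; case: (Bd n (f0 x)).
elim: k f => [|k IH] f fk n; split; rewrite //; try by move=> x; exact: cB fk.
move=> v; have [_ /(_ v)[fv fk']] := fk.
have D x : U x -> is_derive x v (B n \o f) (B n.+1 (f x) * 'D_v f x).
  by move=> Ux; apply: derive_comp_real; exact: fv.
split=> [x /D[]//|].
have := Ck_on_mul Uo (IH _ (Ck_on_pred fk) n.+1) fk'.
by apply: Ck_on_eq => // x /D[_ <-].
Qed.

End Ck_scalar.

Section Ck_row.
Context {R : realType} {m n : nat}.
Implicit Types (U O : set 'rV[R]_m) (f g : 'rV[R]_m -> 'rV[R]_n).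

Lemma row_continuous f x : (forall j, {for x, continuous (fun y => f y 0 j)}) ->
  {for x, continuous f}.
Proof.
move=> fj.
apply: (@cvgrPdist_le _ _ _ (nbhs x) (nbhs_filter x) f (f x)).2 => e e0.
have H : \forall y \near x, forall j, `|f x 0 j - f y 0 j| <= e.
  apply: (@filter_forall _ _ _ (nbhs x) (nbhs_filter x)) => j.
  exact: ((cvgrPdist_le _ _).1 (fj j)).
apply: (@filterS _ (nbhs x) (nbhs_filter x) _ _ _ H) => y Hy.
rewrite /Num.Def.normr/= mx_normrE (bigmax_le _ (ltW e0))//= => -[i j] _.
by rewrite !mxE/= ord1.
Qed.

Lemma coord_continuous_comp f x j : {for x, continuous f} ->
  {for x, continuous (fun y => f y 0 j)}.
Proof.
move=> fc; apply: (@continuous_comp _ _ _ f (fun A : 'rV[R]_n => A 0 j)) => //.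
exact: coord_continuous.
Qed.

Lemma Ck_on_rowP k U f : open U ->
  Ck_on k U f <-> forall j, Ck_on k U (fun x => f x 0 j).
Proof.
move=> Uo; elim: k f => [|k IH] f; split.
- by move=> [fc _] j; split=> // x Ux; apply: coord_continuous_comp; exact: fc.
- by move=> fj; split=> // x Ux; apply: row_continuous => j; exact: (fj j).1.
- move=> [fc fd] j; split=> [x Ux|v].
    by apply: coord_continuous_comp; exact: fc.
  have [fv fk] := fd v; split=> [x Ux|].
    by have /derivable_mxP := fv x Ux; apply.
  have := (IH _).1 fk j; apply: Ck_on_eq => // x Ux.
  by rewrite derive_mx ?mxE//; exact: fv.
- move=> fj; split=> [x Ux|v].
    by apply: row_continuous => j; exact: (fj j).1.
  have fv x : U x -> derivable f x v.
    by move=> Ux; apply/derivable_mxP => i j; rewrite ord1; exact: ((fj j).2 v).1.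
  split=> //; apply/IH => j.
  have := ((fj j).2 v).2; apply: Ck_on_eq => // x Ux.
  by rewrite derive_mx ?mxE//; exact: fv.
Qed.

End Ck_row.

(** * The flat function exp(-1/t) and its derivatives *)

Section flat_function.
Context {R : realType}.
Implicit Types (P : {poly R}) (t : R).

(** The term [s^i / i!] of the exponential series is at most [exp s], so [s^i exp(-s) <= i!]; the
    summand 1 makes [C] positive. *)
Lemma horner_expRN_bounded P :
  exists2 C : R, 0 < C & forall s, 0 < s -> `|P.[s] * expR (- s)| <= C.
Proof.
exists (1 + \sum_(i < size P) `|P`_i| * i`!%:R) => [|s s0].
  by apply: ltr_pwDl => //; apply: sumr_ge0 => i _; rewrite mulr_ge0.
apply: ler_wpDl => //.
rewrite horner_coef mulr_suml; apply: le_trans (ler_norm_sum _ _ _) _.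
apply: ler_sum => i _; rewrite -mulrA normrM ler_wpM2l//.
rewrite ger0_norm; last by rewrite mulr_ge0 ?expR_ge0 ?exprn_ge0 ?ltW.
rewrite expRN ler_pdivrMr ?expR_gt0//.
have fi : (0 : R) < (i : nat)`!%:R by rewrite ltr0n fact_gt0.
rewrite -ler_pdivrMl// mulrC; case: (i : nat) => [|n].
  by rewrite expr0 fact0 divr1 ltW// pexpR_gt1.
by apply: le_trans (expR_ge1Dxn n (ltW s0)); rewrite lerDr.
Qed.

(** For [P = 1] this is the classical flat function; the factor [P(1/t)] makes the family stable
    under differentiation. *)
Definition flat_fun P t : R := if 0 < t then P.[t^-1] * expR (- t^-1) else 0.

(** Bounding [X^2 P] instead of [P] gains the factor [t^2], which yields a zero derivative at 0. *)
Lemma flat_fun_sqr_bound P :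
  exists2 C : R, 0 < C & forall t, `|flat_fun P t| <= C * t ^+ 2.
Proof.
have [C C0 PC] := horner_expRN_bounded ('X^2 * P).
exists C => // t; rewrite /flat_fun; case: ltP => [t0|_]; last first.
  by rewrite normr0 mulr_ge0 ?sqr_ge0// ltW.
have /PC : 0 < t^-1 by rewrite invr_gt0.
rewrite hornerM hornerXn -mulrA normrM ger0_norm ?sqr_ge0//.
by rewrite exprVn ler_pdivrMl ?exprn_gt0// [C * _]mulrC.
Qed.

(* With [s = 1 / t]: [(P(s) exp(-s))' = - s^2 (P'(s) - P(s)) exp(-s)]. *)
Definition flat_poly P : {poly R} := 'X^2 * (P - P^`()).

Lemma is_derive_flat_fun P t :
  is_derive t 1 (flat_fun P) (flat_fun (flat_poly P) t).
Proof.
have [t0|t0|<-] := ltgtP 0 t.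
- have : is_derive t 1 (fun x : R => P.[x^-1] * expR (- x^-1))
      (flat_fun (flat_poly P) t).
    have tn0 : t != 0 by rewrite gt_eqF.
    have dV : is_derive t 1 (fun x : R => x^-1) (- t ^- 2).
      apply: DeriveDef; first by apply: derivableV => //; exact: derivable_id.
      by rewrite deriveV// derive_id [_%:A]mulr1.
    have dP : is_derive t 1 (fun x : R => P.[x^-1]) (P^`().[t^-1] * (- t ^- 2)).
      have dp : is_derive t^-1 1 (horner P) (P^`().[t^-1]).
        apply: DeriveDef; first exact: derivable_horner.
        by rewrite -derive1E -derivE.
      exact: is_derive1_comp.
    have dE : is_derive t 1 (fun x : R => expR (- x^-1))
        (expR (- t^-1) * (t ^- 2)).
      have dN : is_derive t 1 (fun x : R => - x^-1) (t ^- 2).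
        by rewrite -[X in is_derive _ _ _ X]opprK; apply: is_deriveN.
      exact: (is_derive1_comp (f := expR)).
    have D := is_deriveM dP dE; refine (is_derive_eq D _).
    rewrite /flat_fun t0 /flat_poly hornerM hornerXn hornerD hornerN.
    rewrite !/GRing.scale/= -!exprVn; ring.
  apply: near_eq_is_derive; near=> x; rewrite /flat_fun ifT//.
  near: x; exact: lt_nbhsr.
- rewrite /flat_fun [X in is_derive _ _ _ X]ifF; last first.
    by apply/negbTE; rewrite -leNgt ltW.
  have := @is_derive_cst _ R R 0 t 1.
  apply: near_eq_is_derive; near=> x; rewrite /flat_fun ifF//.
  apply/negbTE; rewrite -leNgt ltW//; near: x; exact: lt_nbhsl.
- have F0 Q : flat_fun Q 0 = 0 by rewrite /flat_fun ltxx.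
  (* At 0 the quadratic bound makes the difference quotient at most [C |h|] in absolute value. *)
  rewrite F0; have [C C0 PC] := flat_fun_sqr_bound P.
  suff h0 : (fun h : R => h^-1 *: (flat_fun P (h *: 1 + 0) - flat_fun P 0))
      @ 0^' --> (0 : R).
    by apply: DeriveDef; [apply/cvg_ex; exists 0|exact: cvg_lim].
  apply/cvgr0Pnorm_le => e e0; near=> h.
  rewrite addr0 [_%:A]mulr1 F0 subr0 normrM normfV.
  have hn0 : 0 < `|h| by rewrite normr_gt0; near: h; exact: nbhs_dnbhs_neq.
  rewrite ler_pdivrMl// (le_trans (PC h))// -real_normK ?num_real// expr2 mulrA.
  rewrite mulrC ler_pM2l// mulrC -ler_pdivlMr//.
  by near: h; apply: dnbhs0_le; rewrite divr_gt0.
Unshelve. all: by end_near. Qed.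

End flat_function.

(** * Smooth maps on manifolds and bump functions *)

Section smooth_functions.
Context {R : realType} {m : nat} {M : manifold R m}.
Implicit Types (U O : set M) (c : chart R m M).

(** Near a point of the image, membership amounts to [chart_inv] landing in [U], an open condition
    by continuity. *)
Lemma chart_image_open c U : open U -> open (chart_map c @` (chart_dom c `&` U)).
Proof.
move=> Uo; rewrite openE => x [p [cp Up] <-].
have cpx : (chart_map c @` chart_dom c) (chart_map c p) by exists p.
have nU : nbhs (chart_map c p) (chart_inv c @^-1` U).
  apply: (chart_inv_continuous cpx); rewrite chart_mapK//.
  exact: open_nbhs_nbhs.
have nI : nbhs (chart_map c p) (chart_map c @` chart_dom c).
  by apply: open_nbhs_nbhs; split=> //; exact: chart_img_open.
apply: filterS (filterI nU nI) => y [/= Uy [q cq qy]].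
by exists q => //; split=> //; rewrite -(chart_mapK cq) qy.
Qed.

Section general.
Context {W : normedModType R}.
Implicit Types f g : M -> W.

Lemma smooth_sub U O f : O `<=` U -> smooth U f -> smooth O f.
Proof.
move=> OU fs c ac k; apply: Ck_on_sub (fs c ac k) => _ [p [cp Op] <-].
by exists p => //; split=> //; exact: OU.
Qed.

Lemma smooth_local U f :
  (forall p, U p -> exists2 O, O p & smooth O f) -> smooth U f.
Proof.
move=> fU c ac k; apply: Ck_on_local => _ [p [cp Up] <-].
have [N Np fN] := fU p Up.
by exists (chart_map c @` (chart_dom c `&` N)); [exists p|exact: fN].
Qed.

Lemma smooth_eq U f g : open U -> (forall p, U p -> f p = g p) ->
  smooth U f -> smooth U g.
Proof.
move=> Uo fg fs c ac k; apply: Ck_on_eq (fs c ac k); first exact: chart_image_open.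
by move=> _ [p [cp Up] <-] /=; rewrite chart_mapK// fg.
Qed.

Lemma smooth_cst U (w : W) : smooth U (fun=> w).
Proof. by move=> c ac k; exact: Ck_on_cst. Qed.

End general.

Section scalar.
Implicit Types f g : M -> R.

Lemma smooth_add U f g : open U -> smooth U f -> smooth U g ->
  smooth U (fun p => f p + g p).
Proof.
move=> Uo fs gs c ac k.
exact: (Ck_on_add (chart_image_open Uo) (fs c ac k) (gs c ac k)).
Qed.

Lemma smooth_mul U f g : open U -> smooth U f -> smooth U g ->
  smooth U (fun p => f p * g p).
Proof.
move=> Uo fs gs c ac k.
exact: (Ck_on_mul (chart_image_open Uo) (fs c ac k) (gs c ac k)).
Qed.

Lemma smooth_inv U f : open U -> (forall p, U p -> f p != 0) -> smooth U f ->
  smooth U (fun p => (f p)^-1).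
Proof.
move=> Uo f0 fs c ac k.
apply: (Ck_on_inv (chart_image_open Uo) _ (fs c ac k)).
by move=> _ [p [cp Up] <-] /=; rewrite chart_mapK// f0.
Qed.

Lemma smooth_flat_fun U f (P : {poly R}) : open U -> smooth U f ->
  smooth U (fun p => flat_fun P (f p)).
Proof.
move=> Uo fs c ac k.
apply: (Ck_on_comp_real (B := fun n => flat_fun (iter n flat_poly P))
  (chart_image_open Uo) _ (fs c ac k) 0).
by move=> n x; exact: is_derive_flat_fun.
Qed.

Lemma smooth_sum U (I : Type) (r : seq I) (F : I -> M -> R) : open U ->
  (forall i, smooth U (F i)) -> smooth U (fun p => \sum_(i <- r) F i p).
Proof.
move=> Uo Fs; elim: r => [|i r IH].
  by apply: smooth_eq (smooth_cst U 0) => // p _; rewrite big_nil.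
apply: smooth_eq (smooth_add Uo (Fs i) IH) => // p _.
by rewrite big_cons.
Qed.

End scalar.

Section row.
Context {n : nat}.
Implicit Types f g : M -> 'rV[R]_n.

Lemma smooth_rowP U f : open U ->
  smooth U f <-> forall j, smooth U (fun p => f p 0 j).
Proof.
move=> Uo; split=> fs.
  move=> j c ac k.
  exact: ((Ck_on_rowP _ _ (chart_image_open Uo)).1 (fs c ac k) j).
move=> c ac k; apply/Ck_on_rowP; first exact: chart_image_open.
by move=> j; exact: fs.
Qed.

Lemma smooth_addv U f g : open U -> smooth U f -> smooth U g ->
  smooth U (fun p => f p + g p).
Proof.
move=> Uo /(smooth_rowP _ Uo) fs /(smooth_rowP _ Uo) gs.
apply/(smooth_rowP _ Uo) => j; have := smooth_add Uo (fs j) (gs j).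
by apply: smooth_eq => // p _; rewrite mxE.
Qed.

Lemma smooth_scalev U (h : M -> R) f : open U -> smooth U h -> smooth U f ->
  smooth U (fun p => h p *: f p).
Proof.
move=> Uo hs /(smooth_rowP _ Uo) fs.
apply/(smooth_rowP _ Uo) => j; have := smooth_mul Uo hs (fs j).
by apply: smooth_eq => // p _; rewrite mxE.
Qed.

Lemma smooth_sumv U (I : Type) (r : seq I) (F : I -> M -> 'rV[R]_n) : open U ->
  (forall i, smooth U (F i)) -> smooth U (fun p => \sum_(i <- r) F i p).
Proof.
move=> Uo Fs; elim: r => [|i r IH].
  by apply: smooth_eq (smooth_cst U 0) => // p _; rewrite big_nil.
apply: smooth_eq (smooth_addv Uo (Fs i) IH) => // p _.
by rewrite big_cons.
Qed.

Lemma smooth_form U (G : 'M[R]_n) f g : open U -> smooth U f -> smooth U g ->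
  smooth U (fun p => form G (f p) (g p)).
Proof.
move=> Uo /(smooth_rowP _ Uo) fs /(smooth_rowP _ Uo) gs.
apply: (@smooth_eq _ _ (fun p =>
   \sum_j (\sum_i f p 0 i * G i j) * g p 0 j)) => // [p _|].
  by rewrite /form mxE; apply: eq_bigr => j _; rewrite !mxE.
apply: smooth_sum => // j; apply: smooth_mul => //.
by apply: smooth_sum => // i; apply: smooth_mul => //; exact: smooth_cst.
Qed.

End row.

Lemma smooth_chart_map c : atlas c -> smooth (chart_dom c) (chart_map c).
Proof.
by move=> ac d ad; exact: (atlas_compatible ad ac).
Qed.

End smooth_functions.

(** * Bump functions and global sections *)

Section bump.
Context {R : realType} {m : nat} {M : manifold R m}.

(** In a chart, [phi] is the flat function of [r^2 - |x - x0|^2] for the Euclidean norm, extended by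
    0. The Euclidean ball lies in the closed ball [K0] of the sup norm, whose image in [M] is
    [K]. *)
Lemma bump_exists (p : M) (U : set M) : open U -> U p ->
  exists (phi : M -> R) (K : set M),
    [/\ smooth setT phi, phi p != 0, closed K, K `<=` U &
        forall q, ~ K q -> phi q = 0].
Proof.
move=> Uo Up; have [c ac cp] := @atlas_cover _ _ M p.
pose x0 := chart_map c p.
have : nbhs x0 (chart_map c @` (chart_dom c `&` U)).
  by apply: open_nbhs_nbhs; split; [exact: chart_image_open|exists p].
move=> /nbhs_ballP[e /= e0 eU].
(* Halving [e] puts the closed ball of radius [r] inside the open ball of radius [e]. *)
pose r := e / 2; have r0 : 0 < r by rewrite divr_gt0.
pose K0 : set 'rV[R]_m := closed_ball x0 r.
have K0E x : K0 x <-> `|x0 - x| <= r by rewrite /K0 closed_ballE.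
have K0U : K0 `<=` chart_map c @` (chart_dom c `&` U).
  move=> x /K0E xr; apply: eU; rewrite -ball_normE /ball_/=.
  by rewrite (le_lt_trans xr)// ltr_pdivrMr// ltr_pMr// ltr1n.
have K0c : compact K0.
  apply: bounded_closed_compact; last exact: closed_ball_closed.
  exists (`|x0| + r); split=> [|y ry x /K0E xr]; first exact: num_real.
  rewrite /= (le_trans _ (ltW ry))// -[x](subKr x0).
  by rewrite (le_trans (ler_normB _ _))// lerD2l.
pose K := chart_inv c @` K0.
have KU : K `<=` chart_dom c `&` U.
  by move=> _ [x /K0U[q [cq Uq] <-] <-]; rewrite chart_mapK.
(* [K] is compact, hence closed because [M] is Hausdorff; so the zero function on its complement is
   an extension over an open set. *)
have Kcl : closed K.
  apply: compact_closed; first exact: manifold_hausdorff.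
  apply: continuous_compact K0c; apply: continuous_in_subspaceT => x.
  rewrite inE => /K0U[q [cq _] qx].
  by apply: chart_inv_continuous; exists q.
pose u q : R := r ^+ 2 - \sum_i (chart_map c q 0 i - x0 0 i) ^+ 2.
pose phi q : R := if q \in K then flat_fun 1 (u q) else 0.
exists phi, K; split=> //.
- apply: smooth_local => q _.
  have [cq|ncq] := pselect (chart_dom c q); last first.
    exists (~` K); first by move=> /KU[].
    apply: smooth_eq (smooth_cst _ 0); first exact: closed_openC.
    by move=> q' Kq'; rewrite /phi ifF//; apply/negbTE; rewrite notin_setE.
  exists (chart_dom c) => //; have co := chart_dom_open c.
  apply: (@smooth_eq _ _ _ _ _ (fun q => flat_fun 1 (u q))) => //.
    move=> q' cq'; rewrite /phi; case: ifPn => //.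
    rewrite notin_setE => nK; rewrite /flat_fun ifF//.
    apply/negbTE; rewrite -leNgt subr_le0.
    have : r < `|x0 - chart_map c q'|.
      rewrite ltNge; apply/negP => /K0E cK.
      by apply: nK; exists (chart_map c q') => //; exact: chart_mapK.
    (* The sup norm of the difference exceeds [r], so one of its coordinates does, and the sum of
       squares is at least [r ^+ 2]. The default value 0 of the maximum is ruled out by [r > 0]. *)
    rewrite [X in _ < X]/Num.Def.normr/= mx_normrE.
    move=> /bigmax_gtP[|[[i j] _ /=]]; first by rewrite ltNge ltW.
    rewrite !mxE ord1 => rj; rewrite (bigD1 j)//=.
    apply: ler_wpDr; first by apply: sumr_ge0 => k _; exact: sqr_ge0.
    rewrite -(real_normK (num_real (_ - _))) distrC.
    by rewrite ler_sqr ?nnegrE// ltW.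
  apply: smooth_flat_fun => //.
  have cs := (smooth_rowP _ co).1 (smooth_chart_map ac).
  have ds i : smooth (chart_dom c) (fun q => chart_map c q 0 i - x0 0 i).
    by apply: smooth_add => //; exact: smooth_cst.
  apply: (@smooth_eq _ _ _ _ _ (fun q => r ^+ 2 + (-1) *
     \sum_i (chart_map c q 0 i - x0 0 i) * (chart_map c q 0 i - x0 0 i))) => //.
    by move=> q' _; rewrite /u mulN1r.
  apply: smooth_add => //; first exact: smooth_cst.
  apply: smooth_mul => //; first exact: smooth_cst.
  by apply: smooth_sum => // i; exact: smooth_mul.
- have Kp : K p.
    by exists x0; [apply/K0E; rewrite subrr normr0 ltW|exact: chart_mapK].
  rewrite /phi ifT ?inE// /flat_fun ifT; last first.
    rewrite /u big1 ?subr0 ?exprn_gt0// => i _; rewrite subrr expr0n//.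
  by rewrite hornerC mul1r gt_eqF// expR_gt0.
- by move=> q /KU[].
- by move=> q Kq; rewrite /phi ifF//; apply/negbTE; rewrite notin_setE.
Qed.

(** [U] and the open complement of [K] cover [M], and the product is 0 on the latter. *)
Lemma bump_extension_smooth n (U K : set M) (phi : M -> R) (f : M -> 'rV[R]_n) :
  open U -> smooth U f -> smooth setT phi -> closed K -> K `<=` U ->
  (forall q, ~ K q -> phi q = 0) -> smooth setT (fun q => phi q *: f q).
Proof.
move=> Uo fs phis Kc KU phi0; apply: smooth_local => q _.
have [Uq|nUq] := pselect (U q).
  by exists U => //; apply: smooth_scalev => //; exact: smooth_sub phis.
exists (~` K); first by move=> /KU.
apply: smooth_eq (smooth_cst _ 0); first exact: closed_openC.
by move=> q' Kq'; rewrite phi0// scale0r.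
Qed.

Lemma section_through n k (F : M -> {vspace 'rV[R]_n}) (p : M) x :
  subbundle k F -> x \in F p -> exists2 s, is_section F s & s p = x.
Proof.
move=> Fs xF; have [U [e [Uo Up es eb]]] := Fs p.
have [phi [K [phis phip Kc KU phi0]]] := bump_exists Uo Up.
(* The coefficients in the local frame are constant, and divided by [phi p] so that multiplication
   by [phi] gives exactly [x] at [p]. *)
pose c i := coord [tuple e i p | i < k] i x.
pose f q := \sum_i ((phi p)^-1 * c i) *: e i q.
exists (fun q => phi q *: f q); last first.
  rewrite /f scaler_sumr [RHS](coord_basis (eb p Up) xF).
  apply: eq_bigr => i _.
  by rewrite scalerA mulrA divff// mul1r (nth_map i) ?size_enum_ord// nth_ord_enum.
split=> [|q].
  apply: bump_extension_smooth phis Kc KU phi0 => //.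
  apply: smooth_sumv => // i; apply: smooth_scalev => //; exact: smooth_cst.
have [Kq|nKq] := pselect (K q); last by rewrite phi0// scale0r mem0v.
apply: memvZ; apply: memv_suml => i _; apply: memvZ.
apply: (basis_mem (eb q (KU _ Kq))).
by apply/mapP; exists i; rewrite // mem_enum.
Qed.

End bump.

(** * Isotropic planes and hyperbolic frames *)

Section form_theory.
Context {R : realType} {n : nat} {G : 'M[R]_n}.
Implicit Types (x y z : 'rV[R]_n) (U V W F L : {vspace 'rV[R]_n}).

Lemma formDl x y z : form G (x + y) z = form G x z + form G y z.
Proof. by rewrite /form !mulmxDl mxE. Qed.

Lemma formDr x y z : form G z (x + y) = form G z x + form G z y.
Proof. by rewrite /form linearD/= mulmxDr mxE. Qed.

Lemma formZl (k : R) x y : form G (k *: x) y = k * form G x y.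
Proof. by rewrite /form -!scalemxAl mxE. Qed.

Lemma formZr (k : R) x y : form G x (k *: y) = k * form G x y.
Proof. by rewrite /form linearZ/= -scalemxAr mxE. Qed.

Lemma formBl x y z : form G (x - y) z = form G x z - form G y z.
Proof. by rewrite formDl -scaleN1r formZl mulN1r. Qed.

Lemma formC x y : G^T = G -> form G x y = form G y x.
Proof.
move=> Gs; rewrite /form; have -> : y *m G *m x^T = (x *m G *m y^T)^T.
  by rewrite !trmx_mul trmxK Gs mulmxA.
by rewrite [RHS]mxE.
Qed.

(** This gives uniqueness of the orthogonal projection onto [V], and [projects_on] its existence;
    together they pin down [orth_proj], which chooses by [xget] with default 0. *)
Definition nondegenerate_on V :=
  forall x, x \in V -> (forall y, y \in V -> form G x y = 0) -> x = 0.

Definition projects_on V :=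
  forall w, exists2 u, u \in V & forall y, y \in V -> form G (w - u) y = 0.

Lemma orth_projP V w : projects_on V -> orth_proj G V w \in V /\
  forall y, y \in V -> form G (w - orth_proj G V w) y = 0.
Proof.
move=> Vp; have [u uV wu] := Vp w.
exact: (@xgetPex _ 0 [set u | u \in V /\ forall x, x \in V -> form G (w - u) x = 0]
  (ex_intro _ u (conj uV wu))).
Qed.

Lemma orth_proj_eq V w u : nondegenerate_on V -> u \in V ->
  (forall y, y \in V -> form G (w - u) y = 0) -> orth_proj G V w = u.
Proof.
move=> Vn uV wu; apply: xget_unique => // u' [u'V wu'].
apply/eqP; rewrite -subr_eq0; apply/eqP; apply: Vn; first by rewrite memvB.
move=> y yV; rewrite -[u'](subKr w) -addrA [- _ + _]addrC addrA formBl.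
by rewrite wu// wu'// subr0.
Qed.

End form_theory.

Arguments nondegenerate_on {R n} G V.
Arguments projects_on {R n} G V.

(** * The signature bounds the dimension of isotropic subspaces *)

Section signature.
Context {R : realType} {a b : nat} {G : 'M[R]_(a + b)}.

Lemma signature_sym : has_signature G -> G^T = G.
Proof.
move=> [P Pu PG].
have -> : G = invmx P *m diag_mx (row_mx (const_mx 1) (const_mx (-1))) *m (invmx P)^T.
  by rewrite -PG -!mulmxA -trmx_mul mulVmx// trmx1 mulmx1 mulmxA mulVmx// mul1mx.
by rewrite !trmx_mul trmxK tr_diag_mx mulmxA.
Qed.

(** In the diagonalising coordinates [x *m invmx P], let [L] read off the last [b], negative ones.
    Where [L] vanishes the form is a sum of squares, so [L] is injective on [U]. *)
Lemma isotropic_dim U : has_signature G -> isotropic G U -> (\dim U <= b)%N.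
Proof.
move=> [P Pu PG] Ui.
pose L : 'Hom('rV[R]_(a + b), 'rV[R]_b) := linfun (mulmxr (rsubmx (invmx P))).
have ker0 : (U :&: lker L = 0)%VS.
  apply/eqP; rewrite -subv0; apply/subvP => x; rewrite memv_cap memv0 memv_ker lfunE/=.
  move=> /andP[xU]; rewrite mulmx_rsub => /eqP Lx.
  have xx : form G x x = 0 by exact: Ui.
  pose y := x *m invmx P; have xy : x = y *m P by rewrite /y mulmxKV.
  suff ly : lsubmx y = 0 by rewrite xy -[y]hsubmxK [rsubmx y]Lx ly row_mx0 mul0mx.
  move: xx; rewrite xy /form trmx_mul mulmxA -[y *m P *m G]mulmxA -(mulmxA y) PG.
  rewrite -[y]hsubmxK [rsubmx y]Lx diag_mx_row mul_row_block tr_row_mx mul_row_col.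
  rewrite !mulmx0 !mul0mx !addr0 trmx0 mulmx0 addr0 diag_const_mx mulmx1 mxE.
  under eq_bigr do rewrite [_^T _ _]mxE -expr2.
  move=> /psumr_eq0P y0; apply/rowP => i; rewrite row_mxKl [RHS]mxE.
  by apply/eqP; rewrite -sqrf_eq0 y0// => k _; exact: sqr_ge0.
rewrite -(limg_dim_eq ker0) (leq_trans (dimvS (subvf _)))//.
by rewrite dimvf dim_matrix mul1r.
Qed.

End signature.

Section lines.
Context {K : fieldType} {vT : vectType K}.
Implicit Types (F L : {vspace vT}).

Lemma line_span L x : \dim L = 1%N -> x \in L -> x != 0 -> L = <[x]>%VS.
Proof.
move=> L1 xL x0; apply/esym/eqP; rewrite eqEdim dim_vline x0 L1 andbT.
by rewrite -memvE.
Qed.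

Lemma lines_cap0 L L' : \dim L = 1%N -> \dim L' = 1%N -> L <> L' ->
  (L :&: L' = 0)%VS.
Proof.
move=> L1 L'1 LL'; apply/eqP; rewrite -subv0; apply/subvP => x.
rewrite memv_cap memv0 => /andP[xL xL']; apply: contra_notT LL' => x0.
by rewrite (line_span L1 xL x0) (line_span L'1 xL' x0).
Qed.

Lemma lines_sum F L L' : \dim F = 2 -> \dim L = 1%N -> \dim L' = 1%N ->
  L <> L' -> (L <= F)%VS -> (L' <= F)%VS -> F = (L + L')%VS.
Proof.
move=> F2 L1 L'1 LL' LF L'F; apply/esym/eqP; rewrite eqEdim subv_add LF L'F/=.
by rewrite F2 dimv_disjoint_sum ?L1 ?L'1// lines_cap0.
Qed.

End lines.

Section isotropic_planes.
Context {R : realType} {n : nat} {G : 'M[R]_n}.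
Hypothesis Gsym : G^T = G.
Hypothesis isotropic_le2 : forall U, isotropic G U -> (\dim U <= 2)%N.
Implicit Types F : {vspace 'rV[R]_n}.

(** [F + <[x]>] is again isotropic, so the bound on dimensions forces it to equal [F]. *)
Lemma isotropic_plane_maximal F x : isotropic G F -> \dim F = 2 ->
  form G x x = 0 -> (forall y, y \in F -> form G x y = 0) -> x \in F.
Proof.
move=> Fi F2 xx xF.
have FxI : isotropic G (F + <[x]>)%VS.
  move=> _ _ /memv_addP[y yF [_ /vlineP[k ->] ->]] /memv_addP[z zF [_ /vlineP[l ->] ->]].
  by rewrite !(formDl, formDr, formZl, formZr) xx (formC y x Gsym) !xF// Fi// !mulr0 !addr0.
have /eqP -> : (F == F + <[x]>)%VS.
  by rewrite eqEdim addvSl F2 isotropic_le2.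
by rewrite memvE addvSr.
Qed.

(* If [form G a d = 0] then [d] is orthogonal to [f0], hence in [f0]; then every
   vector of [f1 :&: fh0] is orthogonal to [f0] as well and [f1 = f0]. *)
Lemma opposite_lines_pairing f0 f1 fh0 fh1 a d :
  isotropic G f0 -> isotropic G f1 -> isotropic G fh0 -> isotropic G fh1 ->
  \dim f0 = 2 -> \dim f1 = 2 ->
  \dim (f0 :&: fh0) = 1%N -> \dim (f0 :&: fh1) = 1%N ->
  \dim (f1 :&: fh0) = 1%N -> \dim (f1 :&: fh1) = 1%N ->
  (f0 :&: fh0)%VS <> (f0 :&: fh1)%VS -> f0 <> f1 ->
  a \in (f0 :&: fh0)%VS -> d \in (f1 :&: fh1)%VS -> a != 0 -> d != 0 ->
  form G a d != 0.
Proof.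
move=> i0 i1 ih0 ih1 d0 d1 d00 d01 d10 d11 ns nf as0 dt1 a0 dn0.
apply/negP => /eqP ad; apply: nf.
have f0E : f0 = (f0 :&: fh0 + f0 :&: fh1)%VS by apply: lines_sum; rewrite ?capvSl.
have := dt1; rewrite memv_cap => /andP[df1 dfh1].
have s0E := line_span d00 as0 a0.
have df0 : d \in f0.
  apply: isotropic_plane_maximal => // [|y]; first exact: i1.
  rewrite f0E => /memv_addP[u us0 [v vs1 ->]]; rewrite formDr.
  move: us0; rewrite s0E => /vlineP[k ->]; rewrite formZr formC// ad mulr0 add0r.
  by apply: ih1 => //; move: vs1; rewrite memv_cap => /andP[].
have ds1 : d \in (f0 :&: fh1)%VS by rewrite memv_cap df0.
have s1E := line_span d01 ds1 dn0.
have t0f0 : (f1 :&: fh0 <= f0)%VS.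
  apply/subvP => c; rewrite memv_cap => /andP[cf1 cfh0].
  apply: isotropic_plane_maximal => // [|y]; first exact: i1.
  rewrite f0E => /memv_addP[u us0 [v vs1 ->]]; rewrite formDr.
  rewrite (ih0 c) ?add0r//; last by move: us0; rewrite memv_cap => /andP[].
  by move: vs1; rewrite s1E => /vlineP[k ->]; apply: i1 => //; exact: memvZ.
have t0E : (f1 :&: fh0 = f0 :&: fh0)%VS.
  by apply/eqP; rewrite eqEdim d10 d00 subv_cap t0f0 capvSr.
have t1E : (f1 :&: fh1 = f0 :&: fh1)%VS by rewrite (line_span d11 dt1 dn0).
rewrite f0E -t0E -t1E; apply/esym/lines_sum; rewrite ?capvSl//.
by rewrite t0E t1E.
Qed.

End isotropic_planes.

(** * Hyperbolic frames and the projections they define *)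

Section hyperbolic_frame.
Context {R : realType} {n : nat} {G : 'M[R]_n}.
Hypothesis Gsym : G^T = G.
Implicit Types (a b c d x y w : 'rV[R]_n).

(** The Gram matrix is antidiagonal: [(a, d)] and [(b, c)] are null bases of two mutually orthogonal
    planes of signature (1,1). *)
Definition hyperbolic_frame a b c d :=
  [/\ form G a d != 0, form G b c != 0,
      [/\ form G a a = 0, form G b b = 0, form G c c = 0 & form G d d = 0] &
      [/\ form G a b = 0, form G a c = 0, form G b d = 0 & form G c d = 0]].

(** This is the component of [w] along [a], read off by pairing with the opposite vector [d]. *)
Definition frame_proj a d w := (form G w d / form G a d) *: a.

Section fixed_frame.
Context {a b c d : 'rV[R]_n}.
Hypothesis abcd : hyperbolic_frame a b c d.
Let V : {vspace 'rV[R]_n} := (<[a]> + <[b]> + (<[c]> + <[d]>))%VS.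
Let pr w := frame_proj a d w + frame_proj b c w + (frame_proj c b w + frame_proj d a w).

Lemma frame_flip : [/\ form G d a != 0, form G c b != 0 &
  [/\ form G b a = 0, form G c a = 0, form G d b = 0 & form G d c = 0]].
Proof.
have [ad bc _ [ab ac bd cd]] := abcd.
by split; [rewrite formC|rewrite formC|split; rewrite formC].
Qed.

Lemma mem_frame_proj w : pr w \in V.
Proof. by rewrite !memv_add// memvZ// memv_line. Qed.

Lemma frame_proj_pairing w :
  [/\ form G (pr w) a = form G w a, form G (pr w) b = form G w b,
      form G (pr w) c = form G w c & form G (pr w) d = form G w d].
Proof.
have [ad bc [aa bb cc dd] [ab ac bd cd]] := abcd.
have [da cb [ba ca db dc]] := frame_flip.
rewrite /pr /frame_proj !formDl !formZl aa bb cc dd ab ac bd cd ba ca db dc.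
by rewrite !mulr0 !divfK// ?addr0 ?add0r.
Qed.

Lemma frame_orthogonal w y : form G w a = 0 -> form G w b = 0 ->
  form G w c = 0 -> form G w d = 0 -> y \in V -> form G w y = 0.
Proof.
move=> wa wb wc wd /memv_addP[_ /memv_addP[_ /vlineP[k ->] [_ /vlineP[l ->] ->]]].
move=> [_ /memv_addP[_ /vlineP[k' ->] [_ /vlineP[l' ->] ->]] ->].
by rewrite !formDr !formZr wa wb wc wd !mulr0 !addr0.
Qed.

Lemma frame_residual w y : y \in V -> form G (w - pr w) y = 0.
Proof.
have [wa wb wc wd] := frame_proj_pairing w.
by apply: frame_orthogonal; rewrite formBl ?wa ?wb ?wc ?wd subrr.
Qed.

Lemma frame_expansion x : x \in V -> x = pr x.
Proof.
have [ad bc [aa bb cc dd] [ab ac bd cd]] := abcd.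
have [da cb [ba ca db dc]] := frame_flip.
move=> /memv_addP[_ /memv_addP[_ /vlineP[k ->] [_ /vlineP[l ->] ->]]].
move=> [_ /memv_addP[_ /vlineP[k' ->] [_ /vlineP[l' ->] ->]] ->].
rewrite /pr /frame_proj !formDl !formZl aa bb cc dd ab ac bd cd ba ca db dc.
by rewrite !mulr0 ?addr0 ?add0r !mulfK.
Qed.

Lemma frame_mem : [/\ a \in V, b \in V, c \in V & d \in V].
Proof.
have lV x y z t : x \in (<[x]> + <[y]> + (<[z]> + <[t]>))%VS.
  by rewrite memvE (subv_trans _ (addvSl _ _))// addvSl.
split; rewrite /V; first exact: lV.
- by rewrite [(<[a]> + _)%VS]addvC lV.
- by rewrite addvC lV.
- by rewrite addvC [(<[c]> + _)%VS]addvC lV.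
Qed.

Lemma frame_nondegenerate : nondegenerate_on G V.
Proof.
have [aV bV cV dV] := frame_mem.
move=> x xV x0; rewrite (frame_expansion xV) /pr /frame_proj !x0//.
by rewrite !mul0r !scale0r !addr0.
Qed.

Lemma frame_projects : projects_on G V.
Proof. by move=> w; exists (pr w); [exact: mem_frame_proj|exact: frame_residual]. Qed.

Lemma orth_proj_frame w : orth_proj G V w = pr w.
Proof.
apply: orth_proj_eq frame_nondegenerate (mem_frame_proj w) _ => y.
exact: frame_residual.
Qed.

(** A zero pairing with one frame vector kills the component along the opposite one, so two zero
    pairings leave [x] in the span of the other two. *)
Lemma frame_planes_maximal x : x \in V ->
  [/\ form G x a = 0 -> form G x b = 0 -> x \in (<[a]> + <[b]>)%VS,
      form G x c = 0 -> form G x d = 0 -> x \in (<[c]> + <[d]>)%VS,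
      form G x a = 0 -> form G x c = 0 -> x \in (<[a]> + <[c]>)%VS &
      form G x b = 0 -> form G x d = 0 -> x \in (<[b]> + <[d]>)%VS].
Proof.
move=> /frame_expansion xE.
split=> x1 x2; rewrite xE /pr /frame_proj x1 x2 !mul0r !scale0r ?addr0 ?add0r;
  by rewrite memv_add// memvZ// memv_line.
Qed.

End fixed_frame.

(** The component depends only on the lines of [a] and [d], so generators chosen pointwise by
    [vpick] may be traded for smooth local ones. *)
Lemma frame_proj_scale a d w (k l : R) : k != 0 -> l != 0 ->
  frame_proj (k *: a) (l *: d) w = frame_proj a d w.
Proof.
move=> k0 l0; rewrite /frame_proj !(formZl, formZr) scalerA; congr (_ *: _).
(* For a zero pairing both coefficients vanish, since [0^-1 = 0]. *)
have [->|ad] := eqVneq (form G a d) 0; first by rewrite !mulr0 invr0 !mulr0 mul0r.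
by rewrite !invfM; field; rewrite ad l0 k0.
Qed.

End hyperbolic_frame.

Section planes_frame.
Context {R : realType} {n : nat} {G : 'M[R]_n}.
Hypothesis Gsym : G^T = G.
Hypothesis isotropic_le2 : forall U, isotropic G U -> (\dim U <= 2)%N.
Context {f0 f1 fh0 fh1 : {vspace 'rV[R]_n}}.
Hypotheses (i0 : isotropic G f0) (i1 : isotropic G f1).
Hypotheses (ih0 : isotropic G fh0) (ih1 : isotropic G fh1).
Hypotheses (d0 : \dim f0 = 2) (d1 : \dim f1 = 2).
Hypotheses (dh0 : \dim fh0 = 2) (dh1 : \dim fh1 = 2).
Hypotheses (d00 : \dim (f0 :&: fh0) = 1%N) (d01 : \dim (f0 :&: fh1) = 1%N).
Hypotheses (d10 : \dim (f1 :&: fh0) = 1%N) (d11 : \dim (f1 :&: fh1) = 1%N).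
Hypotheses (s01 : (f0 :&: fh0)%VS <> (f0 :&: fh1)%VS) (f01 : f0 <> f1).
Let a := vpick (f0 :&: fh0)%VS.
Let b := vpick (f0 :&: fh1)%VS.
Let c := vpick (f1 :&: fh0)%VS.
Let d := vpick (f1 :&: fh1)%VS.

(** The two nonzero pairings come from [opposite_lines_pairing], the second after exchanging [fh0]
    and [fh1]; every other pairing is between vectors of a common isotropic plane. *)
Lemma planes_frame : hyperbolic_frame (G := G) a b c d /\
  [/\ f0 = (<[a]> + <[b]>)%VS, f1 = (<[c]> + <[d]>)%VS,
      fh0 = (<[a]> + <[c]>)%VS & fh1 = (<[b]> + <[d]>)%VS].
Proof.
have pick0 L : \dim L = 1%N -> @vpick _ 'rV[R]_n L != 0.
  by move=> L1; rewrite vpick0 -dimv_eq0 L1.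
have sE L : \dim L = 1%N -> <[@vpick _ 'rV[R]_n L]>%VS = L.
  by move=> L1; rewrite -(line_span L1 (memv_pick L) (pick0 _ L1)).
have ad : form G a d != 0.
  by apply: opposite_lines_pairing (memv_pick _) (memv_pick _) _ _ => //; exact: pick0.
have bc : form G b c != 0.
  apply: (opposite_lines_pairing Gsym isotropic_le2 i0 i1 ih1 ih0) (memv_pick _)
    (memv_pick _) _ _ => //; [by move=> /esym|exact: pick0|exact: pick0].
have mem2 U U' : (@vpick _ 'rV[R]_n (U :&: U')%VS \in U) * (vpick (U :&: U')%VS \in U').
  by have /memv_capP[] := memv_pick (U :&: U')%VS.
have [ab ac bd cd] : [/\ form G a b = 0, form G a c = 0, form G b d = 0 & form G c d = 0].
  by split; [apply: i0|apply: ih0|apply: ih1|apply: i1]; rewrite mem2.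
split.
  split=> //; split; [apply: i0|apply: i0|apply: i1|apply: i1]; by rewrite mem2.
(* Lines are told apart by a vector [z] orthogonal to just one of them; this shows that the two
   lines in a plane span it. *)
have ns x y z : form G x z != 0 -> form G y z = 0 -> <[x]>%VS <> <[y]>%VS.
  move=> xz yz xy; move: (memv_line x); rewrite xy => /vlineP[k xE].
  by move: xz; rewrite xE formZl yz mulr0 eqxx.
have cb : form G c b != 0 by rewrite formC.
have da : form G d a != 0 by rewrite formC.
have dline L : \dim L = 1%N -> \dim <[@vpick _ 'rV[R]_n L]>%VS = 1%N by move=> /[dup]/sE ->.
split; apply: lines_sum; rewrite ?dline ?sE ?capvSl ?capvSr//.
- by rewrite -(sE _ d10) -(sE _ d11); apply: (ns _ _ b) => //; rewrite formC.
- by rewrite -(sE _ d00) -(sE _ d10); apply: (ns _ _ d).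
- by rewrite -(sE _ d01) -(sE _ d11); apply: (ns _ _ c) => //; rewrite formC.
Qed.

End planes_frame.

(** * The induced connection and its curvature *)

Section tangent_vectors.
Context {R : realType} {m : nat} {M : manifold R m}.
Implicit Types (X Y : M -> (M -> R) -> R) (p : M).

Lemma tangent_vectorD p v (g h : M -> R) : tangent_vector p v ->
  smooth setT g -> smooth setT h -> v (fun q => g q + h q) = v g + v h.
Proof.
move=> tv gs hs; have [/(_ 1) + _] := tv g h gs hs.
by rewrite mul1r => <-; congr (v _); apply/funext => q; rewrite mul1r.
Qed.

(** In the Leibniz rule the cross terms [X g * Y h + Y g * X h] are symmetric in [X] and [Y] and
    cancel. *)
Lemma lie_bracket_tangent X Y p : vector_field X -> vector_field Y ->
  tangent_vector p (lie_bracket X Y p).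
Proof.
move=> [Xt Xs] [Yt Ys] g h gs hs; split=> [k|]; rewrite /lie_bracket.
  have lin (Z : M -> (M -> R) -> R) : (forall p, tangent_vector p (Z p)) ->
      (fun q => Z q (fun r => k * g r + h r)) = (fun q => k * Z q g + Z q h).
    by move=> Zt; apply/funext => q; exact: (Zt q g h gs hs).1.
  rewrite !lin// (Xt p _ _ (Ys _ gs) (Ys _ hs)).1 (Yt p _ _ (Xs _ gs) (Xs _ hs)).1.
  ring.
have leib (Z : M -> (M -> R) -> R) : (forall p, tangent_vector p (Z p)) ->
    (fun q => Z q (fun r => g r * h r)) = (fun q => g q * Z q h + h q * Z q g).
  by move=> Zt; apply/funext => q; exact: (Zt q g h gs hs).2.
have mulT (f f' : M -> R) : smooth setT f -> smooth setT f' ->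
    smooth setT (fun q => f q * f' q).
  by apply: smooth_mul; exact: openT.
rewrite !leib// (tangent_vectorD (Xt p)) ?(tangent_vectorD (Yt p)); try by apply: mulT; auto.
rewrite (Xt p _ _ gs (Ys _ hs)).2 (Xt p _ _ hs (Ys _ gs)).2.
rewrite (Yt p _ _ gs (Xs _ hs)).2 (Yt p _ _ hs (Xs _ gs)).2.
ring.
Qed.

Context {n : nat}.
Implicit Types s t : M -> 'rV[R]_n.

Lemma dvecD p v s t : tangent_vector p v -> smooth setT s -> smooth setT t ->
  dvec v (fun q => s q + t q) = dvec v s + dvec v t.
Proof.
move=> tv /(smooth_rowP _ openT) ss /(smooth_rowP _ openT) ts.
apply/rowP => j; rewrite !mxE -(tangent_vectorD tv)//.
by congr (v _); apply/funext => q; rewrite mxE.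
Qed.

Lemma dvec_smooth X s : vector_field X -> smooth setT s ->
  smooth setT (fun q => dvec (X q) s).
Proof.
move=> [_ Xs] /(smooth_rowP _ openT) ss; apply/(smooth_rowP _ openT) => j.
by apply: smooth_eq (Xs _ (ss j)); [exact: openT|move=> q _; rewrite mxE].
Qed.

End tangent_vectors.

Section subbundles.
Context {R : realType} {m n : nat} {M : manifold R m} {G : 'M[R]_n}.
Implicit Types (F S T : M -> {vspace 'rV[R]_n}).

Lemma subbundle_dim k F p : subbundle k F -> \dim (F p) = k.
Proof. by move=> /(_ p)[U [e [_ Up _ /(_ p Up)/size_basis]]]. Qed.

Lemma line_bundle_frame S p : subbundle 1 S -> exists U (e : M -> 'rV[R]_n),
  [/\ open U, U p, smooth U e & forall q, U q -> e q \in S q /\ e q != 0].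
Proof.
move=> /(_ p)[U [e [Uo Up es eb]]]; exists U, (e ord0); split=> // q Uq.
have ein : e ord0 q \in [tuple e i q | i < 1].
  by apply/mapP; exists ord0; rewrite // mem_enum.
split; first exact: basis_mem (eb q Uq) ein.
exact: free_not0 (basis_free (eb q Uq)) ein.
Qed.

(** [vpick] need not be smooth, but locally smooth generators [e] and [e'] of the two lines give the
    same component. *)
Lemma smooth_frame_proj S T (w : M -> 'rV[R]_n) : subbundle 1 S -> subbundle 1 T ->
  (forall q, form G (vpick (S q)) (vpick (T q)) != 0) -> smooth setT w ->
  smooth setT (fun q => frame_proj (G := G) (vpick (S q)) (vpick (T q)) (w q)).
Proof.
move=> S1 T1 ST ws; apply: smooth_local => p _.
have [U [e [Uo Up es eS]]] := line_bundle_frame p S1.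
have [U' [e' [U'o U'p e's e'T]]] := line_bundle_frame p T1.
have UUo := openI Uo U'o.
have pickE L x : \dim L = 1%N -> x \in L -> x != 0 ->
    exists2 k : R, k != 0 & x = k *: @vpick _ 'rV[R]_n L.
  move=> L1 xL x0.
  have p0 : @vpick _ 'rV[R]_n L != 0 by rewrite vpick0 -dimv_eq0 L1.
  have /vlineP[k xE] : x \in <[vpick L]>%VS by rewrite -(line_span L1 (memv_pick L) p0).
  by exists k => //; apply/eqP => k0; move: x0; rewrite xE k0 scale0r eqxx.
have picks q : (U `&` U') q -> exists k l : R, [/\ k != 0, l != 0,
    e q = k *: vpick (S q) & e' q = l *: vpick (T q)].
  move=> [/eS[eS' e0] /e'T[eT' e'0]].
  have [k k0 ->] := pickE _ _ (subbundle_dim q S1) eS' e0.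
  have [l l0 ->] := pickE _ _ (subbundle_dim q T1) eT' e'0.
  by exists k, l.
exists (U `&` U') => //.
apply: (@smooth_eq _ _ _ _ _
  (fun q => (form G (w q) (e' q) * (form G (e q) (e' q))^-1) *: e q)) => //.
  by move=> q /picks[k [l [k0 l0 -> ->]]]; exact: frame_proj_scale.
have wU : smooth (U `&` U') w by exact: smooth_sub ws.
have eU : smooth (U `&` U') e by apply: smooth_sub es => ? [].
have e'U : smooth (U `&` U') e' by apply: smooth_sub e's => ? [].
apply: smooth_scalev => //; apply: smooth_mul => //; first exact: smooth_form.
apply: smooth_inv => //; last exact: smooth_form.
move=> q /picks[k [l [k0 l0 -> ->]]].
by rewrite formZl formZr !mulf_neq0.
Qed.

End subbundles.

(** * Projection in the quotient compared with projection onto [V] *)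

Section quotients.
Context {R : realType} {n : nat} {G : 'M[R]_n}.
Implicit Types (V F : {vspace 'rV[R]_n}) (x y : 'rV[R]_n).

Lemma coset_subE s x y : coset_sub (coset s x) (coset s y) = coset s (x - y).
Proof.
apply/seteqP; split=> [_ [a ax [b bx <-]]|w wxy].
  have E : a - b - (x - y) = (a - x) - (b - y) by apply/rowP => j; rewrite !mxE; ring.
  by rewrite /coset/= E memvB.
exists (w + y); last by exists y; rewrite /coset/= ?subrr ?mem0v// addrK.
have E : w + y - x = w - (x - y) by apply/rowP => j; rewrite !mxE; ring.
by rewrite /coset/= E.
Qed.

(** In other words, [F] is a Lagrangian subspace of [V]. *)
Definition self_orthogonal_in V F := [/\ (F <= V)%VS, isotropic G F &
  forall x, x \in V -> (forall y, y \in F -> form G x y = 0) -> x \in F].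

(** Two candidates for the projection differ by a vector of [F + Fh] orthogonal to both [F] and
    [Fh], hence lying in each of them. Conversely [F :&: Fh] is orthogonal to [F + Fh]. *)
Lemma quot_projE V F Fh w : projects_on G V ->
  self_orthogonal_in V F -> self_orthogonal_in V Fh ->
  orth_proj G V w \in (F + Fh)%VS ->
  quot_proj G (F + Fh)%VS (coset (F :&: Fh)%VS w) =
  coset (F :&: Fh)%VS (orth_proj G V w).
Proof.
move=> Vp [FV Fi Fmax] [FhV Fhi Fhmax]; set u0 := orth_proj G V w => u0W.
have WV : (F + Fh <= V)%VS by rewrite subv_add FV.
have wu0 y : y \in (F + Fh)%VS -> form G (w - u0) y = 0.
  by move=> yW; apply: (orth_projP w Vp).2; exact: (subvP WV).
have sW x y : x \in (F :&: Fh)%VS -> y \in (F + Fh)%VS -> form G x y = 0.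
  move=> /memv_capP[xF xFh] /memv_addP[y1 y1F [y2 y2F ->]].
  by rewrite formDr Fi// Fhi// addr0.
apply/seteqP; split=> [u [uW [w' ww' w'u]]|u us].
  have u0u y : y \in (F + Fh)%VS -> form G (u - u0) y = 0.
    (* All three differences are orthogonal to [F + Fh]: the first by projection onto [V], the
       second as an element of [F :&: Fh], the third by the choice of [u]. *)
    move=> yW; have -> : u - u0 = (w - u0) + (w' - w) - (w' - u).
      by apply/rowP => j; rewrite !mxE; ring.
    by rewrite formBl formDl wu0// sW// w'u// !addr0 subr0.
  have uV : u - u0 \in V by apply: (subvP WV); exact: memvB.
  rewrite /coset/= memv_cap Fmax ?Fhmax// => y yF; apply: u0u.
    by rewrite -[y]add0r memv_add ?mem0v.
  by rewrite -[y]addr0 memv_add ?mem0v.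
have uW : u \in (F + Fh)%VS.
  rewrite -[u](subrK u0) memvD//; apply: (subvP _ _ us).
  exact: subv_trans (capvSl _ _) (addvSl _ _).
split=> //; exists w; first by rewrite /coset/= subrr mem0v.
move=> y yW; rewrite -[u](subrK u0) opprD addrCA addrC formDl wu0// add0r.
by rewrite -scaleN1r formZl sW// mulr0.
Qed.

End quotients.

Arguments self_orthogonal_in {R n} G V F.

Section connection.
Context {R : realType} {m n : nat} {M : manifold R m} {G : 'M[R]_n}.
Context {V : M -> {vspace 'rV[R]_n}}.
Hypothesis Vproj : forall p, projects_on G (V p).
Hypothesis Vnondeg : forall p, nondegenerate_on G (V p).
Hypothesis Vsmooth : forall w : M -> 'rV[R]_n, smooth setT w ->
  smooth setT (fun q => orth_proj G (V q) (w q)).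
Implicit Types (X Y : M -> (M -> R) -> R) (F L : M -> {vspace 'rV[R]_n}).

Lemma orth_projD p x y :
  orth_proj G (V p) (x + y) = orth_proj G (V p) x + orth_proj G (V p) y.
Proof.
have [xV xp] := orth_projP x (@Vproj p); have [yV yp] := orth_projP y (@Vproj p).
apply: orth_proj_eq; [exact: Vnondeg|exact: memvD|move=> z zV].
by rewrite opprD addrACA formDl xp// yp// addr0.
Qed.

Lemma nabla_add p v s t : tangent_vector p v -> smooth setT s -> smooth setT t ->
  nabla G V p v (fun q => s q + t q) = nabla G V p v s + nabla G V p v t.
Proof. by move=> tv ss ts; rewrite /nabla (dvecD tv)// orth_projD. Qed.

Lemma nabla_smooth X s : vector_field X -> smooth setT s ->
  smooth setT (fun q => nabla G V q (X q) s).
Proof. by move=> Xv ss; apply: Vsmooth; exact: dvec_smooth. Qed.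

Definition curvature X Y (s : M -> 'rV[R]_n) p :=
  nabla G V p (X p) (fun q => nabla G V q (Y q) s)
    - nabla G V p (Y p) (fun q => nabla G V q (X q) s)
    - nabla G V p (lie_bracket X Y p) s.

(** Additivity allows the curvature to be tested on the components of a section along the four
    lines. *)
Lemma curvature_add X Y s t p : vector_field X -> vector_field Y ->
  smooth setT s -> smooth setT t ->
  curvature X Y (fun q => s q + t q) p = curvature X Y s p + curvature X Y t p.
Proof.
move=> Xv Yv ss ts; have nadd Z : vector_field Z ->
    (fun q => nabla G V q (Z q) (fun r => s r + t r)) =
    (fun q => nabla G V q (Z q) s + nabla G V q (Z q) t).
  by move=> [Zt _]; apply/funext => q; apply: nabla_add.
rewrite /curvature !nadd// !nabla_add//.
all: try by [exact: nabla_smooth|exact: Xv.1|exact: Yv.1|exact: lie_bracket_tangent].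
have regroup (x x' y y' z z' : 'rV[R]_n) :
    x + x' - (y + y') - (z + z') = (x - y - z) + (x' - y' - z').
  by apply/rowP => j; rewrite !mxE; ring.
exact: regroup.
Qed.

(** Since [F] lies in [V], [dvec v s] and its projection have the same pairings with [F p].
    Extending [y] to a section makes the Legendre condition apply to them. *)
Lemma legendre_parallel F : legendre G F ->
  (forall p, self_orthogonal_in G (V p) (F p)) -> parallel_subbundle 2 G V F.
Proof.
move=> [F2 _ FL] FV; split=> // [p|s sF p v tv]; first by have [] := FV p.
have [FVp _ Fmax] := FV p.
have [nV np] := orth_projP (dvec v s) (@Vproj p).
apply: Fmax => // y yF; have [t tF tp] := section_through F2 yF.
have := np y (subvP FVp _ yF); rewrite formBl -[in form G (dvec v s) y]tp.
by rewrite FL// => /eqP; rewrite sub0r oppr_eq0 => /eqP.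
Qed.

Lemma parallel_cap F Fh k k' l : subbundle l (fun p => F p :&: Fh p)%VS ->
  parallel_subbundle k G V F -> parallel_subbundle k' G V Fh ->
  parallel_subbundle l G V (fun p => F p :&: Fh p)%VS.
Proof.
move=> s1 [_ FV Fp] [_ _ Fhp]; split=> // [p|s [ss sF] p v tv].
  exact: subv_trans (capvSl _ _) (FV p).
rewrite memv_cap Fp ?Fhp//; split=> // q; by have /memv_capP[] := sF q.
Qed.

(* Along a parallel line bundle in [F + Fh] the connections of [V] and of
   [(F + Fh) / (F :&: Fh)] agree, so the flatness of the latter confines the
   curvature there to [F :&: Fh]. *)
Lemma curvature_line X Y F Fh L k s p : flatN G F Fh ->
  (forall q, self_orthogonal_in G (V q) (F q)) ->
  (forall q, self_orthogonal_in G (V q) (Fh q)) ->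
  parallel_subbundle k G V L -> (forall q, L q <= F q + Fh q)%VS ->
  (forall q, L q :&: (F q :&: Fh q) = 0)%VS ->
  vector_field X -> vector_field Y -> is_section L s -> curvature X Y s p = 0.
Proof.
move=> FFh FV FhV [_ _ Lp] LW LFF Xv Yv sL.
have nL Z : vector_field Z -> is_section L (fun q => nabla G V q (Z q) s).
  move=> Zv; split=> [|q]; first by apply: nabla_smooth => //; exact: sL.1.
  by apply: Lp => //; exact: Zv.1.
have LWs t : is_section L t -> is_section (fun q => F q + Fh q)%VS t.
  by move=> [ts tL]; split=> // q; exact: subvP (LW q) _ (tL q).
have nN q v t : is_section L t -> tangent_vector q v ->
    nablaN G F Fh q v t = coset (F q :&: Fh q)%VS (nabla G V q v t).
  move=> tL tv; apply: quot_projE => //.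
  by apply: subvP (LW q) _ _; exact: Lp.
have Xt := Xv.1; have Yt := Yv.1; have XYt := lie_bracket_tangent p Xv Yv.
(* The lifts [muX] and [muY] in [flatN] are taken to be the derivatives of [s] in [V], which are
   again sections of [L]. *)
have := FFh X Y Xv Yv s _ _ (LWs _ sL) (LWs _ (nL _ Xv)) (LWs _ (nL _ Yv))
  (fun q => esym (nN q _ _ sL (Xt q))) (fun q => esym (nN q _ _ sL (Yt q))) p.
rewrite !nN//; [|exact: nL|exact: nL].
rewrite !coset_subE -/(curvature X Y s p) => cE.
have cF : curvature X Y s p \in (F p :&: Fh p)%VS.
  have : coset (F p :&: Fh p)%VS (curvature X Y s p) (curvature X Y s p).
    by rewrite /coset/= subrr mem0v.
  by rewrite cE /coset/= subr0.
have cL : curvature X Y s p \in L p.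
  by rewrite !memvB//; apply: Lp => //; exact: nL.
by apply/eqP; rewrite -memv0 -(LFF p) memv_cap cL.
Qed.

End connection.

(** * The four intersection lines and the curvature of [V] *)

Lemma ribaucour_pair_line (R : realType) (m : nat) (M : manifold R m) (n : nat)
    (G : 'M[R]_n) (f fh : M -> {vspace 'rV[R]_n}) :
  ribaucour_pair G f fh -> subbundle 1 (fun p => f p :&: fh p)%VS.
Proof.
move=> [_ _ _ [s [[s1 _] _ _ sE]] _].
by rewrite -(_ : s = fun p => (f p :&: fh p)%VS)//; apply/funext.
Qed.

Theorem theorem3p2 (R : realType) (m : nat) (M : manifold R m)
    (G : 'M[R]_(m + 2 + 2)) (hG : has_signature (a := m + 2) (b := 2) G)
    (f0 f1 fh0 fh1 : M -> {vspace 'rV[R]_(m + 2 + 2)})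
    (h00 : ribaucour_pair G f0 fh0)
    (h01 : ribaucour_pair G f0 fh1)
    (hs : forall p, (f0 p :&: fh0 p)%VS <> (f0 p :&: fh1 p)%VS)
    (hf1 : legendre G f1)
    (h10 : ribaucour_pair G f1 fh0)
    (h11 : ribaucour_pair G f1 fh1)
    (hf : forall p, f0 p <> f1 p) :
  let V := fun p => (fh0 p + fh1 p)%VS in
  flat G V /\
  [/\ parallel_subbundle 2 G V f0, parallel_subbundle 2 G V f1,
      parallel_subbundle 2 G V fh0 & parallel_subbundle 2 G V fh1].
Proof.
move=> V.
have Gsym := signature_sym hG.
have Gdim U := @isotropic_dim R (m + 2) 2 G U hG.
have s0l := ribaucour_pair_line h00; have s1l := ribaucour_pair_line h01.
have t0l := ribaucour_pair_line h10; have t1l := ribaucour_pair_line h11.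
have [f0L fh0L _ _ flat00] := h00; have [_ fh1L _ _ flat01] := h01.
have [_ _ _ _ flat10] := h10; have [_ _ _ _ flat11] := h11.
have [f0b f0i _] := f0L; have [f1b f1i _] := hf1.
have [fh0b fh0i _] := fh0L; have [fh1b fh1i _] := fh1L.
pose a q := vpick (f0 q :&: fh0 q)%VS; pose b q := vpick (f0 q :&: fh1 q)%VS.
pose c q := vpick (f1 q :&: fh0 q)%VS; pose d q := vpick (f1 q :&: fh1 q)%VS.
have frame q : hyperbolic_frame (G := G) (a q) (b q) (c q) (d q) /\
    [/\ f0 q = (<[a q]> + <[b q]>)%VS, f1 q = (<[c q]> + <[d q]>)%VS,
        fh0 q = (<[a q]> + <[c q]>)%VS & fh1 q = (<[b q]> + <[d q]>)%VS].
  by apply: planes_frame => //; first [exact: subbundle_dim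
    | exact: (subbundle_dim _ s0l) | exact: (subbundle_dim _ s1l)
    | exact: (subbundle_dim _ t0l) | exact: (subbundle_dim _ t1l)].
have VE q : V q = (<[a q]> + <[b q]> + (<[c q]> + <[d q]>))%VS.
  have [_ [_ _ E E']] := frame q; rewrite /V E E' -!addvA.
  by congr (_ + _)%VS; rewrite !addvA [(<[c q]> + _)%VS]addvC.
(* This second splitting places [f0] and [f1] inside [V]. *)
have VE' q : V q = (f0 q + f1 q)%VS by have [_ [-> -> _ _]] := frame q; exact: VE.
have Vproj p : projects_on G (V p).
  by rewrite VE; apply: frame_projects => //; exact: (frame p).1.
have Vnon p : nondegenerate_on G (V p).
  by rewrite VE; apply: frame_nondegenerate => //; exact: (frame p).1.
have Pad w : smooth setT w ->
    smooth setT (fun q => frame_proj (G := G) (a q) (d q) (w q)).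
  by apply: smooth_frame_proj => // q; have [[]] := frame q.
have Pbc w : smooth setT w ->
    smooth setT (fun q => frame_proj (G := G) (b q) (c q) (w q)).
  by apply: smooth_frame_proj => // q; have [[]] := frame q.
have Pcb w : smooth setT w ->
    smooth setT (fun q => frame_proj (G := G) (c q) (b q) (w q)).
  by apply: smooth_frame_proj => // q; rewrite formC//; have [[]] := frame q.
have Pda w : smooth setT w ->
    smooth setT (fun q => frame_proj (G := G) (d q) (a q) (w q)).
  by apply: smooth_frame_proj => // q; rewrite formC//; have [[]] := frame q.
have addS (s t : M -> 'rV[R]_(m + 2 + 2)) : smooth setT s -> smooth setT t ->
    smooth setT (fun q => s q + t q) by apply: smooth_addv; exact: openT.
(* In the frame the projection onto [V] is the sum of four components, each smooth. *)
have Vsmooth w : smooth setT w -> smooth setT (fun q => orth_proj G (V q) (w q)).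
  move=> ws; have := addS _ _ (addS _ _ (Pad _ ws) (Pbc _ ws)) (addS _ _ (Pcb _ ws) (Pda _ ws)).
  apply: smooth_eq => [|q _]; first exact: openT.
  by rewrite VE orth_proj_frame//; exact: (frame q).1.
have so q : [/\ self_orthogonal_in G (V q) (f0 q), self_orthogonal_in G (V q) (f1 q),
    self_orthogonal_in G (V q) (fh0 q) & self_orthogonal_in G (V q) (fh1 q)].
  have l (y z : 'rV[R]_(m + 2 + 2)) : y \in (<[y]> + <[z]>)%VS by rewrite memvE addvSl.
  have r (y z : 'rV[R]_(m + 2 + 2)) : z \in (<[y]> + <[z]>)%VS by rewrite memvE addvSr.
  have [hfr [e0 e1 eh0 eh1]] := frame q.
  split; (split=> // [|x]; first by
    [exact: addvSl|exact: addvSr|rewrite VE' addvSl|rewrite VE' addvSr]);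
    rewrite VE => /(frame_planes_maximal Gsym hfr)[m0 m1 mh0 mh1];
    rewrite ?e0 ?e1 ?eh0 ?eh1 => xF;
    by [apply: m0; apply: xF|apply: m1; apply: xF|apply: mh0; apply: xF
       |apply: mh1; apply: xF].
have f0o q : self_orthogonal_in G (V q) (f0 q) by have [] := so q.
have f1o q : self_orthogonal_in G (V q) (f1 q) by have [] := so q.
have fh0o q : self_orthogonal_in G (V q) (fh0 q) by have [] := so q.
have fh1o q : self_orthogonal_in G (V q) (fh1 q) by have [] := so q.
have f0p := legendre_parallel Vproj f0L f0o.
have f1p := legendre_parallel Vproj hf1 f1o.
have fh0p := legendre_parallel Vproj fh0L fh0o.
have fh1p := legendre_parallel Vproj fh1L fh1o.
split=> // X Y Xv Yv s [ss sV] p; rewrite -/(curvature (G := G) (V := V) X Y s p).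
(* If these lines coincided, [c] and [d] would be the same vector, while [b] pairs to 0 with [d] and
   not with [c]. *)
have t01 q : (f1 q :&: fh0 q)%VS <> (f1 q :&: fh1 q)%VS.
  move=> t01; have [[_ bc _ [_ _ bd _]] _] := frame q.
  by move: bc; rewrite /c t01 bd eqxx.
pose sa q := frame_proj (G := G) (a q) (d q) (s q).
pose sb q := frame_proj (G := G) (b q) (c q) (s q).
pose sc q := frame_proj (G := G) (c q) (b q) (s q).
pose sd q := frame_proj (G := G) (d q) (a q) (s q).
have sE : s = fun q => sa q + sb q + (sc q + sd q).
  apply/funext => q; apply: frame_expansion => //; first exact: (frame q).1.
  by rewrite -VE.
have [sas sbs] := (Pad s ss, Pbc s ss); have [scs sds] := (Pcb s ss, Pda s ss).
(* A section of [F :&: Fh] is handled by the flatness of the other pair [F], [Fh']: this line lies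
   in [F + Fh'] and meets [F :&: Fh'] only in 0. *)
have line0 (F Fh Fh' : M -> {vspace 'rV[R]_(m + 2 + 2)}) t :
    flatN G F Fh' -> (forall q, self_orthogonal_in G (V q) (F q)) ->
    (forall q, self_orthogonal_in G (V q) (Fh' q)) ->
    parallel_subbundle 2 G V F -> parallel_subbundle 2 G V Fh ->
    subbundle 1 (fun q => F q :&: Fh q)%VS -> subbundle 1 (fun q => F q :&: Fh' q)%VS ->
    (forall q, (F q :&: Fh q)%VS <> (F q :&: Fh' q)%VS) -> smooth setT t ->
    (forall q, exists k, t q = k *: vpick (F q :&: Fh q)%VS) ->
    curvature (G := G) (V := V) X Y t p = 0.
  move=> fl Fo Fho Fp Fhp L1 L'1 LL' ts tL.
  apply: (curvature_line Vproj Vsmooth p fl Fo Fho (parallel_cap L1 Fp Fhp)) => // [q|q|].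
  - by rewrite (subv_trans (capvSl _ _))// addvSl.
  - by apply: lines_cap0 => //; [exact: (subbundle_dim _ L1)|exact: (subbundle_dim _ L'1)].
  - by split=> // q; have [k ->] := tL q; rewrite memvZ// memv_pick.
rewrite sE (curvature_add Vproj Vnon Vsmooth)//; [|exact: addS|exact: addS].
rewrite !(curvature_add Vproj Vnon Vsmooth)//.
rewrite (line0 f0 fh0 fh1 sa)//; last by move=> q; eexists; reflexivity.
rewrite (line0 f0 fh1 fh0 sb)//; [|by move=> q /esym; apply: hs|by move=> q; eexists; reflexivity].
rewrite (line0 f1 fh0 fh1 sc)//; last by move=> q; eexists; reflexivity.
rewrite (line0 f1 fh1 fh0 sd)//; [|by move=> q /esym; apply: t01|by move=> q; eexists; reflexivity].
by rewrite !addr0.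
Qed.
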